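(* Let $\vec r(t)=(x(t),y(t),z(t))$, $t_0<t<t_1$, be a simple curve of class $C^2$ in $\mathbb{R}^3$ that does not pass through the origin $O=(0,0,0)$ and does not meet any of the coordinate axes ($x$-, $y$- and $z$-axes). Let $P=P(t)=(x(t),y(t),z(t))$ be the moving point on the curve with parameter $t$. Then for every $t\in(t_0,t_1)$: (i) For $\mathcal{D}=|\overrightarrow{OP}|$, we have $$\frac{d\mathcal{D}}{dt}=\frac{x(t)x'(t)+y(t)y'(t)+z(t)z'(t)}{\sqrt{x^2(t)+y^2(t)+z^2(t)}}.$$ (ii) The rotational speed of $\overrightarrow{OP}_A=(x(t),y(t),0)$ with respect to $t$ is $\dfrac{|x(t)y'(t)-x'(t)y(t)|}{x^2(t)+y^2(t)}$. (iii) The rotational speed of $\overrightarrow{OP}_B=(x(t),0,z(t))$ with respect to $t$ is $\dfrac{|x(t)z'(t)-x'(t)z(t)|}{x^2(t)+z^2(t)}$. (iv) The rotational speed of $\overrightarrow{OP}_C=(0,y(t),z(t))$ with respect to $t$ is $\dfrac{|y(t)z'(t)-y'(t)z(t)|}{y^2(t)+z^2(t)}$.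
   Context: For a nowhere-zero differentiable vector function $\vec w(t)$, write $\vec e_{\vec w}=\vec w/|\vec w|$. The rotational speed of $\vec w$ with respect to $t$ is $\left|\frac{d\vec e_{\vec w}}{dt}\right|$. *)

(* Defs.v *)
From HB Require Import structures.
From mathcomp Require Import all_boot all_order all_algebra.
From mathcomp Require Import all_classical all_reals all_analysis.

Set Implicit Arguments.
Unset Strict Implicit.
Unset Printing Implicit Defensive.

Import Order.TTheory GRing.Theory Num.Theory.
Import numFieldNormedType.Exports.

Local Open Scope classical_set_scope.
Local Open Scope ring_scope.

(* The library norm on 'rV[R]_n is the sup norm; derivatives in 'rV[R]_n do not
   depend on the choice of norm, but lengths do. *)
Definition enorm (R : realType) (n : nat) (v : 'rV[R]_n) : R :=
  Num.sqrt (\sum_(i < n) v 0 i ^+ 2).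

Definition vec3 (R : realType) (a b c : R) : 'rV[R]_3 :=
  \row_(j < 3) [:: a; b; c]`_j.

Definition curve3 (R : realType) (x y z : R -> R) (t : R) : 'rV[R]_3 :=
  vec3 (x t) (y t) (z t).

Definition coord_axis (R : realType) (i : 'I_3) : set 'rV[R]_3 :=
  [set v | forall j : 'I_3, j != i -> v 0 j = 0].

Definition class_C2 (R : realType) (V : normedModType R) (I : interval R)
    (f : R -> V) : Prop :=
  forall t : R, t \in I ->
    [/\ derivable f t 1, derivable (derive1 f) t 1
      & {for t, continuous (derive1 (derive1 f))}].

Definition simple_curve (R : realType) (n : nat) (I : interval R)
    (f : R -> 'rV[R]_n) : Prop :=
  {in I &, injective f}.

Definition direction (R : realType) (n : nat) (w : R -> 'rV[R]_n.+1) (t : R) :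
    'rV[R]_n.+1 :=
  (enorm (w t))^-1 *: w t.

Definition rotational_speed (R : realType) (n : nat) (w : R -> 'rV[R]_n.+1)
    (t : R) : R :=
  enorm (derive1 (direction w) t).

(* [derive1] and [^-1] are total, so the statement that the rotational speed
   of [w] at [t] is [s] includes that the quantities involved are meaningful. *)
Definition has_rotational_speed (R : realType) (n : nat)
    (w : R -> 'rV[R]_n.+1) (t s : R) : Prop :=
  [/\ w t != 0, derivable w t 1, derivable (direction w) t 1
    & rotational_speed w t = s].

(* Main.v *)
(* For a nowhere-zero curve r, differentiating r / |r| gives
   |(r / |r|)'|^2 = |r'|^2 / |r|^2 - (r . r')^2 / |r|^4 = |r x r'|^2 / |r|^4
   by Lagrange's identity.  Parts (ii)-(iv) apply this to the three projections;
   a projection onto a coordinate plane vanishes exactly when r lies on the axis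
   orthogonal to that plane. *)

Require Import Defs.
From HB Require Import structures.
From mathcomp Require Import all_boot all_order all_algebra.
From mathcomp Require Import all_classical all_reals all_analysis.
From mathcomp Require Import ring.

Set Implicit Arguments.
Unset Strict Implicit.
Unset Printing Implicit Defensive.

Import Order.TTheory GRing.Theory Num.Theory.
Import numFieldNormedType.Exports.

Local Open Scope classical_set_scope.
Local Open Scope ring_scope.

Section SpaceCurve.
Variable R : realType.
Implicit Types (x y z : R -> R) (a b c t : R).

Lemma vec3_eq0 a b c : (vec3 a b c == 0) = [&& a == 0, b == 0 & c == 0].
Proof.
apply/eqP/and3P => [/rowP v0|[/eqP-> /eqP-> /eqP->]].
  have := v0 0; have := v0 1; have := v0 2%:R.
  by rewrite !mxE /= => -> -> ->; rewrite eqxx.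
by apply/rowP => -[[|[|[|//]]] ?]; rewrite !mxE.
Qed.

Lemma enorm_vec3 a b c :
  enorm (vec3 a b c) = Num.sqrt (a ^+ 2 + b ^+ 2 + c ^+ 2).
Proof. by rewrite /enorm !big_ord_recr big_ord0 /= add0r !mxE. Qed.

Lemma scale_vec3 k a b c : k *: vec3 a b c = vec3 (k * a) (k * b) (k * c).
Proof. by apply/rowP => -[[|[|[|//]]] ?]; rewrite !mxE. Qed.

Lemma sumsq3_gt0 a b c : vec3 a b c != 0 -> 0 < a ^+ 2 + b ^+ 2 + c ^+ 2.
Proof.
rewrite vec3_eq0 lt_def !addr_ge0 ?sqr_ge0// andbT.
by rewrite !paddr_eq0 ?addr_ge0 ?sqr_ge0// !sqrf_eq0 -andbA.
Qed.

(** Derivability and derivatives of matrix-valued functions are entrywise, and each entry of the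
    curve is one of [x], [y], [z]. *)
Lemma is_derive_curve3 x y z t a b c :
  is_derive t 1 x a -> is_derive t 1 y b -> is_derive t 1 z c ->
  is_derive t 1 (curve3 x y z) (vec3 a b c).
Proof.
move=> xa yb zc.
have coord (j : 'I_3) :
    is_derive t 1 (fun s => curve3 x y z s 0 j) (vec3 a b c 0 j).
  have -> : (fun s => curve3 x y z s 0 j) = [:: x; y; z]`_j.
    by apply/funext => s; rewrite mxE; case: j => -[|[|[|//]]] ?.
  by rewrite mxE; case: j => -[|[|[|//]]] ?.
have dr : derivable (curve3 x y z) t 1.
  by apply/derivable_mxP => i j; rewrite ord1; case: (coord j).
apply: DeriveDef => //; rewrite derive_mx//.
by apply/matrixP => i j; rewrite mxE ord1; case: (coord j).
Qed.

Lemma curve3_derivable x y z t : derivable (curve3 x y z) t 1 ->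
  [/\ derivable x t 1, derivable y t 1 & derivable z t 1].
Proof.
move=> /derivable_mxP dr; split.
- by have := dr 0 0; under eq_fun do rewrite mxE.
- by have := dr 0 1; under eq_fun do rewrite mxE.
- by have := dr 0 2%:R; under eq_fun do rewrite mxE.
Qed.

(** Chain rule for the square root, whose argument is positive off the origin. It serves part (i)
    and the derivative of 1/|r| below. *)
Lemma is_derive_enorm_curve3 x y z t a b c :
  is_derive t 1 x a -> is_derive t 1 y b -> is_derive t 1 z c ->
  curve3 x y z t != 0 ->
  is_derive t 1 (fun s => enorm (curve3 x y z s))
    ((x t * a + y t * b + z t * c) / enorm (curve3 x y z t)).
Proof.
move=> xa yb zc /sumsq3_gt0 S_gt0.
rewrite [X in is_derive _ _ X](_ : _ = Num.sqrt \o (x ^+ 2 + y ^+ 2 + z ^+ 2));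
  last first.
  by apply/funext => s; rewrite enorm_vec3.
rewrite enorm_vec3.
have sqrt_neq0 : Num.sqrt (x t ^+ 2 + y t ^+ 2 + z t ^+ 2) != 0.
  by rewrite gt_eqF// sqrtr_gt0.
apply: is_derive_eq.
  by apply: is_derive1_comp; apply: is_derive1_sqrt.
by rewrite /GRing.scale /= !expr1; field.
Qed.

(** Stated for a general space curve, so that each projection is the case of one coordinate
    constantly 0. The radicand is |r x r'|^2. *)
Lemma has_rotational_speed_curve3 x y z t :
  derivable x t 1 -> derivable y t 1 -> derivable z t 1 ->
  curve3 x y z t != 0 ->
  has_rotational_speed (curve3 x y z) t
    (Num.sqrt ((x t * derive1 y t - derive1 x t * y t) ^+ 2
             + (x t * derive1 z t - derive1 x t * z t) ^+ 2
             + (y t * derive1 z t - derive1 y t * z t) ^+ 2)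
     / (x t ^+ 2 + y t ^+ 2 + z t ^+ 2)).
Proof.
move=> /derivableP + /derivableP + /derivableP; rewrite -!derive1E.
set a := derive1 x t; set b := derive1 y t; set c := derive1 z t.
move=> xa yb zc r_neq0.
have S_gt0 := sumsq3_gt0 r_neq0.
have dN := is_derive_enorm_curve3 xa yb zc r_neq0.
pose N s := enorm (curve3 x y z s).
have N2 : N t ^+ 2 = x t ^+ 2 + y t ^+ 2 + z t ^+ 2.
  by rewrite /N enorm_vec3 sqr_sqrtr// ltW.
have N_gt0 : 0 < N t by rewrite /N enorm_vec3 sqrtr_gt0.
have N_neq0 : N t != 0 by rewrite gt_eqF.
(* [p] is r . r', so N' = p / N and (1/N)' = - p / N^3. *)
pose p := x t * a + y t * b + z t * c.
have dVN : is_derive t 1 (fun s => (N s)^-1) (- p / N t ^+ 3).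
  have dV := is_deriveV N_neq0 dN; apply: (is_derive_eq dV).
  by rewrite /GRing.scale /= -/(N t) /p; field.
have dir (f : R -> R) (d : R) : is_derive t 1 f d ->
    is_derive t 1 (fun s => (N s)^-1 * f s) (d / N t - f t * p / N t ^+ 3).
  move=> fd; have dM := is_deriveM dVN fd; apply: (is_derive_eq dM).
  by rewrite /GRing.scale /=; field.
have ddir := is_derive_curve3 (dir _ _ xa) (dir _ _ yb) (dir _ _ zc).
(* Valid for every [s], even where [N s] is 0, since both sides use the same total inverse. *)
have dirE : direction (curve3 x y z) =
    curve3 (fun s => (N s)^-1 * x s) (fun s => (N s)^-1 * y s)
           (fun s => (N s)^-1 * z s).
  by apply/funext => s; rewrite /direction scale_vec3.
split => //.
- by case: (is_derive_curve3 xa yb zc).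
- by rewrite dirE; case: ddir.
rewrite /rotational_speed dirE derive1E; case: ddir => _ ->.
(* The positive denominator moves under the root, so that only the radicands remain to be
   compared. *)
rewrite enorm_vec3 -[X in _ = _ / X]ger0_norm ?ltW// -sqrtr_sqr.
rewrite -[in RHS]sqrtrV ?sqr_ge0// -[in RHS]sqrtrM ?addr_ge0 ?sqr_ge0//.
congr Num.sqrt.
(* Expansion of |r'/N - p r/N^3|^2, with r . r' = p in the cross term. *)
transitivity ((a ^+ 2 + b ^+ 2 + c ^+ 2) / N t ^+ 2 - 2 * p ^+ 2 / N t ^+ 4
              + (x t ^+ 2 + y t ^+ 2 + z t ^+ 2) * p ^+ 2 / N t ^+ 6).
  by rewrite /p; field.
(* Since |r|^2 = N^2, the last two terms combine to - p^2 / N^4. *)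
transitivity
  (((a ^+ 2 + b ^+ 2 + c ^+ 2) * N t ^+ 2 - p ^+ 2) / (N t ^+ 2) ^+ 2).
  by rewrite -N2; field.
(* Lagrange's identity: [|r|^2 |r'|^2 - (r . r')^2 = |r x r'|^2] *)
by rewrite N2 /p; congr (_ / _); ring.
Qed.

End SpaceCurve.

Theorem proposition3p1 (R : realType) (t0 t1 : R) (x y z : R -> R)
  (r_simple : simple_curve `]t0, t1[ (curve3 x y z))
  (r_C2 : class_C2 `]t0, t1[ (curve3 x y z))
  (r_origin : forall t, t \in `]t0, t1[ -> curve3 x y z t != 0)
  (r_axes : forall t (i : 'I_3), t \in `]t0, t1[ ->
     ~ coord_axis i (curve3 x y z t)) :
  forall t, t \in `]t0, t1[ ->
  [/\ is_derive t 1 (fun s => enorm (curve3 x y z s))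
        ((x t * derive1 x t + y t * derive1 y t + z t * derive1 z t)
         / Num.sqrt (x t ^+ 2 + y t ^+ 2 + z t ^+ 2)),
      has_rotational_speed (curve3 x y (fun=> 0)) t
        (`|x t * derive1 y t - derive1 x t * y t| / (x t ^+ 2 + y t ^+ 2)),
      has_rotational_speed (curve3 x (fun=> 0) z) t
        (`|x t * derive1 z t - derive1 x t * z t| / (x t ^+ 2 + z t ^+ 2))
    & has_rotational_speed (curve3 (fun=> 0) y z) t
        (`|y t * derive1 z t - derive1 y t * z t| / (y t ^+ 2 + z t ^+ 2))].
Proof.
move=> t tI.
have r_neq0 := r_origin t tI.
have [dx dy dz] : [/\ derivable x t 1, derivable y t 1 & derivable z t 1].
  by apply: curve3_derivable; case: (r_C2 t tI).
have d0 : derivable (fun=> 0 : R) t 1 by exact: derivable_cst.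
have der0 : derive1 (fun=> 0 : R) t = 0 by rewrite derive1_cst.
(* A projection [w] whose vanishing would put the point on axis [i] is nonzero, as the curve avoids
   the axes. *)
have off_axis (i : 'I_3) (w : 'rV[R]_3) :
    (w == 0 -> forall j, j != i -> curve3 x y z t 0 j = 0) -> w != 0.
  by move=> axis; apply/negP => /axis; exact: r_axes.
split.
- rewrite -enorm_vec3 !derive1E.
  by apply: is_derive_enorm_curve3 => //; exact: derivableP.
- have xy_neq0 : curve3 x y (fun=> 0) t != 0.
    apply: (off_axis 2%:R); rewrite vec3_eq0 => /and3P[/eqP x0 /eqP y0 _].
    by move=> -[[|[|[|//]]] ?] //; rewrite mxE.
  (* With z = z' = 0 only one component of r x r' survives, and the root of its square is the
     absolute value. *)
  have := has_rotational_speed_curve3 dx dy d0 xy_neq0.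
  by rewrite der0 !(mulr0, mul0r, subr0, expr0n) /= !(addr0, add0r) sqrtr_sqr.
- have xz_neq0 : curve3 x (fun=> 0) z t != 0.
    apply: (off_axis 1); rewrite vec3_eq0 => /and3P[/eqP x0 _ /eqP z0].
    by move=> -[[|[|[|//]]] ?] //; rewrite mxE.
  have := has_rotational_speed_curve3 dx d0 dz xz_neq0.
  by rewrite der0 !(mulr0, mul0r, subr0, expr0n) /= !(addr0, add0r) sqrtr_sqr.
- have yz_neq0 : curve3 (fun=> 0) y z t != 0.
    apply: (off_axis 0); rewrite vec3_eq0 => /and3P[_ /eqP y0 /eqP z0].
    by move=> -[[|[|[|//]]] ?] //; rewrite mxE.
  have := has_rotational_speed_curve3 d0 dy dz yz_neq0.
  by rewrite der0 !(mulr0, mul0r, subr0, expr0n) /= !(addr0, add0r) sqrtr_sqr.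
Qed.
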